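(* Every integral domain of finite $t$-character, and in particular every TV domain, is polynomially L-regular. Likewise, every integral domain of finite character is polynomially L-regular.
   Context: For an integral domain $A$ with quotient field $L$, $\operatorname{Int}(A) = \{f(X) \in L[X] : f(A) \subset A\}$. A domain $D$ is polynomially L-regular if $\operatorname{Int}(S^{-1}D) = S^{-1}\operatorname{Int}(D)$ for every multiplicative subset $S$ of $D$ (with $0\notin S$). Let $D$ be a domain with quotient field $K$. A fractional ideal is a $D$-submodule $I$ of $K$ with $dI\subset D$ for some nonzero $d \in D$; $I^{-1} = \{x \in K : xI \subset D\}$, $I_v = (I^{-1})^{-1}$, and $I_t = \bigcup J_v$, where $J$ ranges over the nonzero finitely generated fractional ideals contained in $I$. A $t$-ideal (resp. $v$-ideal) is a nonzero fractional ideal $I$ with $I = I_t$ (resp. $I = I_v$). A $t$-maximal ideal is an ideal maximal among the $t$-ideals properly contained in $D$. $D$ is a TV domain if every $t$-ideal of $D$ is a $v$-ideal. $D$ is of finite $t$-character (resp. of finite character) if every nonzero element of $D$ lies in only finitely many $t$-maximal (resp. maximal) ideals of $D$. *)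

(* Defs.v *)
From HB Require Import structures.
From mathcomp Require Import all_boot all_order all_algebra.
From mathcomp Require Import boolp classical_sets functions cardinality.

Set Implicit Arguments.
Unset Strict Implicit.
Unset Printing Implicit Defensive.

Import GRing.Theory.
Local Open Scope classical_set_scope.
Local Open Scope ring_scope.

(* The quotient field K of D is {fraction D}.  D itself, its localizations and
   its (fractional) ideals are subsets of {fraction D}. *)
Notation "x %:K" := (@FracField.tofrac _ x) (at level 2, format "x %:K").

Definition dom (D : idomainType) : set {fraction D} := range (@FracField.tofrac D).
Arguments dom D : clear implicits.

(* [int_poly A] is Int(A) for a domain A lying between D and {fraction D}, so
   that {fraction D} is also the quotient field of A. *)
Definition int_poly (D : idomainType) (A : set {fraction D}) :
    set {poly {fraction D}} :=
  [set f | forall a, A a -> A f.[a]].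

Definition multiplicative_subset (D : idomainType) (S : set D) : Prop :=
  GRing.mulr_closed (mem S) /\ ~ S 0.

Definition loc_dom (D : idomainType) (S : set D) : set {fraction D} :=
  [set a%:K / s%:K | a in [set: D] & s in S].

Definition loc_poly (D : idomainType) (S : set D)
    (F : set {poly {fraction D}}) : set {poly {fraction D}} :=
  [set s%:K^-1 *: f | s in S & f in F].

Definition poly_L_regular (D : idomainType) : Prop :=
  forall S : set D, multiplicative_subset S ->
    int_poly (loc_dom S) = loc_poly S (int_poly (dom D)).

Definition submodule (D : idomainType) (I : set {fraction D}) : Prop :=
  I 0 /\ forall (a : D) u v, I u -> I v -> I (a%:K * u + v).

Definition fractional_ideal (D : idomainType) (I : set {fraction D}) : Prop :=
  submodule I /\
  exists2 d : D, d != 0 & forall x, I x -> dom D (d%:K * x).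

Definition nonzero_fractional_ideal (D : idomainType)
    (I : set {fraction D}) : Prop :=
  fractional_ideal I /\ exists2 x, I x & x != 0.

Definition fin_gen (D : idomainType) (I : set {fraction D}) : Prop :=
  exists e : seq {fraction D},
    I = [set \sum_(i < size e) (c i)%:K * e`_i | c in [set: 'I_(size e) -> D]].

Definition inv_ideal (D : idomainType) (I : set {fraction D}) :
    set {fraction D} :=
  [set x | forall y, I y -> dom D (x * y)].

Definition v_closure (D : idomainType) (I : set {fraction D}) :
    set {fraction D} :=
  inv_ideal (inv_ideal I).

Definition t_closure (D : idomainType) (I : set {fraction D}) :
    set {fraction D} :=
  \bigcup_(J in [set J | [/\ nonzero_fractional_ideal J, fin_gen J & J `<=` I]])
    v_closure J.

Definition t_ideal (D : idomainType) (I : set {fraction D}) : Prop :=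
  nonzero_fractional_ideal I /\ I = t_closure I.

Definition v_ideal (D : idomainType) (I : set {fraction D}) : Prop :=
  nonzero_fractional_ideal I /\ I = v_closure I.

Definition t_maximal (D : idomainType) (M : set {fraction D}) : Prop :=
  [/\ t_ideal M, M `<` dom D &
      forall J, t_ideal J -> J `<` dom D -> M `<=` J -> J = M].

(* [idealr_closed] includes properness. *)
Definition maximal_ideal (D : idomainType) (M : set D) : Prop :=
  idealr_closed (mem M) /\
  forall J : set D, idealr_closed (mem J) -> M `<=` J -> J = M.

Definition TV_domain (D : idomainType) : Prop :=
  forall I : set {fraction D}, t_ideal I -> v_ideal I.

Definition finite_t_character (D : idomainType) : Prop :=
  forall d : D, d != 0 ->
    finite_set [set M : set {fraction D} | t_maximal M /\ M d%:K].

Definition finite_character (D : idomainType) : Prop :=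
  forall d : D, d != 0 ->
    finite_set [set M : set D | maximal_ideal M /\ M d].

(* Main.v *)
Require Import Defs.
From mathcomp Require Import all_boot all_order all_algebra.
From mathcomp Require Import boolp classical_sets cardinality.
From mathcomp Require Import ring.

Set Implicit Arguments.
Unset Strict Implicit.
Unset Printing Implicit Defensive.

(* Let D be covered by a family of proper ideals with finite character: each
   x outside D has its denominator ideal (D : x) inside some member M.  Given f
   in Int(S^-1 D) and d <> 0 with d f in D[X], only the finitely many M
   containing d matter.  If M misses S, then f(D), being inside S^-1 D, gives
   no obstruction at M.  If s is in both S and M, then the differences
   s^i (s^(j-i) - 1) of the nodes 1, s, ..., s^n are products of a power of s
   and an element outside M, so interpolation at these nodes gives t in S and
   u outside M with t u f in D[X].  Multiplying the t's yields a denominator in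
   S for f.  Maximal ideals cover D, and so do t-maximal ideals because the
   ideals (D : x) are divisorial; TV domains have finite t-character. *)

Import GRing.Theory.
Local Open Scope classical_set_scope.
Local Open Scope ring_scope.

(** * Denominators and interpolation over D *)

Section Localization.
Variable D : idomainType.
Implicit Types (x y z : {fraction D}) (f g : {poly {fraction D}}) (S : set D).

Lemma dom_tofrac (a : D) : dom D a%:K.
Proof. by exists a. Qed.

Lemma dom0 : dom D 0.
Proof. by exists 0; rewrite // tofrac0. Qed.

Lemma domD x y : dom D x -> dom D y -> dom D (x + y).
Proof. by case=> a _ <- [b _ <-]; exists (a + b); rewrite // tofracD. Qed.

Lemma domN x : dom D x -> dom D (- x).
Proof. by case=> a _ <-; exists (- a); rewrite // tofracN. Qed.

Lemma domM x y : dom D x -> dom D y -> dom D (x * y).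
Proof. by case=> a _ <- [b _ <-]; exists (a * b); rewrite // tofracM. Qed.

Lemma dom_sum (I : finType) (F : I -> {fraction D}) :
  (forall i, dom D (F i)) -> dom D (\sum_i F i).
Proof. by move=> domF; apply: big_ind => //; [exact: dom0 | exact: domD]. Qed.

Lemma dom_denominator x : exists2 d : D, d != 0 & dom D (d%:K * x).
Proof.
elim/quotW: x => r; exists \d_r; first exact: denom_ratioP.
exists \n_r => //; rewrite /FracField.tofrac; unlock.
rewrite -[RHS]FracField.pi_mul; apply/eqmodP => /=.
rewrite FracField.equivfE /FracField.mulf.
rewrite !numden_Ratio ?mulf_neq0 ?oner_eq0 ?denom_ratioP //.
by rewrite !mul1r mulrC.
Qed.

(** The product of the individual witnesses serves every index. This clears denominators and, later,
    merges the conditions at finitely many ideals. *)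
Lemma common_multiple (S : set D) (T : eqType) (P : T -> D -> Prop)
    (e : seq T) :
  S 1 -> (forall s t, S s -> S t -> S (s * t)) ->
  (forall i s t, P i s -> P i (s * t)) ->
  (forall i, i \in e -> exists2 s, S s & P i s) ->
  exists2 s, S s & forall i, i \in e -> P i s.
Proof.
move=> S1 SM PM; elim: e => [|i e IHe] Pe; first by exists 1.
have [s Ss Ps] := Pe i (mem_head _ _).
have [|t St Pt] := IHe; first by move=> j je; apply: Pe; rewrite inE je orbT.
exists (s * t); first exact: SM.
move=> j; rewrite inE => /predU1P[->|/Pt]; first exact: PM.
by rewrite mulrC; exact: PM.
Qed.

Lemma poly_denominator f :
  exists2 d : D, d != 0 & forall k, dom D (d%:K * f`_k).
Proof.
have [||i s t Ps||d d0 Pd] := @common_multiple [set d | d != 0] _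
  (fun k d => dom D (d%:K * f`_k)) (iota 0 (size f)).
- exact: oner_neq0.
- by move=> s t /=; exact: mulf_neq0.
- by rewrite tofracM mulrAC; apply: domM => //; exact: dom_tofrac.
- by move=> k _; have [d d0 dk] := dom_denominator f`_k; exists d.
exists d => // k; have [kf|kf] := ltnP k (size f).
  by apply: Pd; rewrite mem_iota.
by rewrite nth_default // mulr0; exact: dom0.
Qed.

Lemma dom_horner (c : {fraction D}) f (a : D) :
  (forall k, dom D (c * f`_k)) -> dom D (c * f.[a%:K]).
Proof.
move=> cf; rewrite horner_coef mulr_sumr; apply: dom_sum => i.
by rewrite mulrA -tofracXn; apply: domM => //; exact: dom_tofrac.
Qed.

(** Cramer's rule: the coefficient row times the Vandermonde matrix is the row of values, and the
    adjugate inverts this up to the determinant. *)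
Lemma dom_Vandermonde_coef n f (a : 'rV[D]_n) c :
  (size f <= n)%N -> (forall j, dom D (c * f.[(a 0 j)%:K])) ->
  forall k, dom D (c * (\det (Vandermonde n a))%:K * f`_k).
Proof.
move=> fn cf k; have [kf|kf] := ltnP k n; last first.
  by rewrite nth_default ?mulr0 ?(leq_trans fn) //; exact: dom0.
pose V := map_mx (@FracField.tofrac D) (Vandermonde n a).
pose r := \row_(i < n) f`_i.
have rV j : (r *m V) 0 j = f.[(a 0 j)%:K].
  rewrite mxE (horner_coef_wide _ fn); apply: eq_bigr => i _.
  by rewrite !mxE tofracXn.
have := mul_mx_adj V; rewrite det_map_mx -map_mx_adj => adjV.
have -> : c * (\det (Vandermonde n a))%:K * f`_k =
    \sum_j c * f.[(a 0 j)%:K] * (\adj (Vandermonde n a) j (Ordinal kf))%:K.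
  rewrite -mulrA; have /rowP/(_ (Ordinal kf)) := congr1 (mulmx r) adjV.
  rewrite mulmxA mul_mx_scalar !mxE /= => <-; rewrite mulr_sumr.
  by apply: eq_bigr => j _; rewrite rV mxE mulrA.
by apply: dom_sum => j; apply: domM => //; exact: dom_tofrac.
Qed.

(** Elements of this form are closed under products, and each difference of nodes has it. The factor
    [1 + s * c] avoids every proper ideal containing [s]; the sign stays apart because -1 need not
    lie in a multiplicative subset. *)
Lemma det_Vandermonde_geometric (s : D) n :
  exists N e (c : D), \det (Vandermonde n (\row_(i < n) s ^+ i)) =
    s ^+ N * (-1) ^+ e * (1 + s * c).
Proof.
rewrite det_Vandermonde.
pose geo (z : D) := exists N e c, z = s ^+ N * (-1) ^+ e * (1 + s * c).
have geo1 : geo 1 by exists 0%N, 0%N, 0; rewrite mulr0 addr0 !mulr1.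
have geoM (y z : D) : geo y -> geo z -> geo (y * z).
  move=> [N [e [c ->]]] [N' [e' [c' ->]]].
  exists (N + N')%N, (e + e')%N, (c + c' + s * c * c'); rewrite !exprD.
  by move: ((-1) ^+ e) ((-1) ^+ e') => u u'; ring.
apply: (big_ind geo) => // i _; apply: (big_ind geo) => // j ij; rewrite !mxE.
(* As [i < j], [s ^+ j - s ^+ i = s ^+ i * (-1) * (1 - s * s ^+ (j - i.+1))]. *)
exists i, 1%N, (- s ^+ (j - i.+1)).
rewrite -{1}(subnKC ij) addSnnS exprD exprS; ring.
Qed.

End Localization.

(** * Integer-valued polynomials over S^-1 D *)

Section MultiplicativeSubset.
Variables (D : idomainType) (S : set D).
Hypothesis multS : multiplicative_subset S.
Implicit Types (x y z : {fraction D}) (f g : {poly {fraction D}}).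

Lemma mult_subset1 : S 1.
Proof. by case: multS => -[]; rewrite inE. Qed.

Lemma mult_subsetM s t : S s -> S t -> S (s * t).
Proof.
by case: multS => -[_ SM] _ Ss St; have := SM s t; rewrite !inE; apply.
Qed.

Lemma mult_subsetX s n : S s -> S (s ^+ n).
Proof.
move=> Ss; elim: n => [|n Sn]; first exact: mult_subset1.
by rewrite exprS; exact: mult_subsetM.
Qed.

Lemma mult_subset_neq0 s : S s -> s%:K != 0.
Proof.
by move=> Ss; rewrite tofrac_eq0; apply/eqP => s0; case: multS; rewrite -s0.
Qed.

Lemma loc_domP x : loc_dom S x <-> exists2 s, S s & dom D (s%:K * x).
Proof.
split=> [[a _ [s Ss <-]]|[s Ss [a _ ax]]].
  exists s => //; rewrite mulrC divfK ?mult_subset_neq0 //; exact: dom_tofrac.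
exists a => //; exists s => //.
by rewrite ax mulrC mulKf ?mult_subset_neq0.
Qed.

Lemma loc_polyP f :
  loc_poly S (int_poly (dom D)) f <->
  exists2 s, S s & forall a : D, dom D (s%:K * f.[a%:K]).
Proof.
split=> [[s Ss [g intg <-]]|[s Ss sf]].
  exists s => // a; rewrite hornerZ mulrA divff ?mult_subset_neq0 // mul1r.
  by apply: intg; exact: dom_tofrac.
exists s => //; exists (s%:K *: f).
  by move=> _ [a _ <-]; rewrite hornerZ; exact: sf.
by rewrite scalerA mulVf ?mult_subset_neq0 // scale1r.
Qed.


(* Induction on the degree: [s ^+ n *: f - f(s X)] is integer-valued of degree
   less than [n]. *)
Lemma int_poly_loc_dom n f s (a : D) : (size f <= n)%N ->
  int_poly (dom D) f -> S s -> loc_dom S f.[a%:K / s%:K].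
Proof.
elim: n f => [|n IHn] f fn intf Ss.
  move: fn; rewrite leqn0 size_poly_eq0 => /eqP ->; rewrite horner0.
  apply/loc_domP; exists 1; first exact: mult_subset1.
  by rewrite mulr0; exact: dom0.
pose h := \poly_(i < n.+1) (s%:K ^+ i * f`_i).
have hE x : h.[x] = f.[s%:K * x].
  rewrite horner_poly (horner_coef_wide _ fn); apply: eq_bigr => i _.
  by rewrite exprMn; ring.
have hk k : h`_k = s%:K ^+ k * f`_k.
  rewrite coef_poly; case: ltnP => // nk.
  by rewrite nth_default ?mulr0 // (leq_trans fn).
pose g := s%:K ^+ n *: f - h.
have gn : (size g <= n)%N.
  apply/leq_sizeP => k; rewrite leq_eqVlt => /predU1P[<-|nk].
    by rewrite coefB coefZ hk subrr.
  by rewrite coefB coefZ hk nth_default ?mulr0 ?subrr // (leq_trans fn).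
have intg : int_poly (dom D) g.
  move=> _ [b _ <-]; rewrite hornerD hornerN hornerZ hE -tofracXn -tofracM.
  apply: domD; last by apply/domN/intf/dom_tofrac.
  by apply: domM; [exact: dom_tofrac | exact/intf/dom_tofrac].
have /loc_domP[t St tg] := IHn g gn intg Ss.
apply/loc_domP; exists (t * s ^+ n).
  by apply: mult_subsetM => //; exact: mult_subsetX.
rewrite tofracM tofracXn -mulrA.
(* At [a / s] the polynomial [h] takes the value [f.[a]]. *)
rewrite (_ : _ * f.[_] = g.[a%:K / s%:K] + f.[a%:K]); last first.
  rewrite hornerD hornerN hornerZ hE [_ * (_ / _)]mulrC.
  by rewrite divfK ?mult_subset_neq0 ?subrK.
rewrite mulrDr; apply: domD => //.
by apply: domM; [exact: dom_tofrac | exact/intf/dom_tofrac].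
Qed.

(** The values of [f] at the nodes [s ^+ i] have a common denominator in S. Interpolation multiplies
    it by the Vandermonde determinant, whose factor [s ^+ N] is absorbed into S. *)
Lemma int_poly_loc_dom_coef f s : int_poly (loc_dom S) f -> S s ->
  exists2 t, S t & exists c, forall k, dom D (t%:K * (1 + s * c)%:K * f`_k).
Proof.
move=> intf Ss; pose n := size f.
have [||i u v Pu||t St tf] := @common_multiple D S _
  (fun (i : 'I_n) t => dom D (t%:K * f.[(s ^+ i)%:K])) (enum 'I_n).
- exact: mult_subset1.
- exact: mult_subsetM.
- by rewrite tofracM mulrAC; apply: domM => //; exact: dom_tofrac.
- move=> i _; apply/loc_domP/intf; exists (s ^+ i) => //.
  by exists 1; [exact: mult_subset1 | rewrite tofrac1 divr1].
have [N [e [c detV]]] := det_Vandermonde_geometric s n.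
exists (t * s ^+ N).
  by apply: mult_subsetM => //; exact: mult_subsetX.
exists c => k.
have := @dom_Vandermonde_coef D n f (\row_(i < n) s ^+ i) t%:K (leqnn _) _ k.
rewrite detV => H.
have {}H : dom D (t%:K * (s ^+ N * (-1) ^+ e * (1 + s * c))%:K * f`_k).
  by apply: H => j; rewrite mxE; apply: tf; rewrite mem_enum.
(* A second factor [(-1) ^+ e] cancels the sign. *)
rewrite (_ : _ * f`_k = ((-1) ^+ e)%:K *
    (t%:K * (s ^+ N * (-1) ^+ e * (1 + s * c))%:K * f`_k)).
  by apply: domM => //; exact: dom_tofrac.
rewrite !mulrA -!tofracM; congr (_%:K * _).
rewrite [RHS](_ : _ =
    ((-1) ^+ e * (-1) ^+ e) * (t * s ^+ N * (1 + s * c))); last by ring.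
by rewrite -expr2 sqrr_sign mul1r.
Qed.

End MultiplicativeSubset.

(** * Regularity from a cover of finite character *)

Lemma poly_L_regular_finite_cover (D : idomainType) (Omega : set (set D)) :
  (forall M, Omega M -> idealr_closed (mem M)) ->
  (forall d : D, d != 0 -> finite_set [set M | Omega M /\ M d]) ->
  (forall x, ~ dom D x ->
    exists2 M, Omega M & forall y : D, dom D (y%:K * x) -> M y) ->
  poly_L_regular D.
Proof.
move=> idealM finM coverM S multS; apply/seteqP; split=> f; last first.
  case=> s Ss [g intg <-] _ [a _ [t St <-]]; rewrite hornerZ.
  have /(loc_domP multS)[u Su ug] := int_poly_loc_dom multS a (leqnn _) intg St.
  apply/(loc_domP multS); exists (s * u); first exact: mult_subsetM.
  rewrite tofracM [s%:K * _]mulrC -mulrA mulVKf //.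
  exact: (mult_subset_neq0 multS).
move=> intf; apply/(loc_polyP multS).
have [d d0 df] := poly_denominator f.
have /finite_seqP[e eM] := finM d d0.
(* The condition is conditional on M meeting S, so an M disjoint from S accepts the denominator
   1. *)
pose P (M : set D) s := (exists2 t, S t & M t) ->
  exists2 u, ~ M u & forall k, dom D (s%:K * u%:K * f`_k).
have [||M s t Ps /Ps[u Mu uf]||s Ss sP] := @common_multiple D S _ P e.
- exact: mult_subset1.
- exact: mult_subsetM.
- exists u => // k.
  rewrite [(s * t)%:K]tofracM -!mulrA mulrCA.
  apply: domM; first exact: dom_tofrac.
  by rewrite mulrA.
- move=> M eMM.
  have [[t St Mt]|nM] := pselect (exists2 t, S t & M t); last first.
    by exists 1; [exact: mult_subset1 | move=> /nM].
  have [s Ss [c cf]] := int_poly_loc_dom_coef multS intf St.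
  exists s => // _; exists (1 + t * c) => // Mtc.
  have [OM _] : [set M | Omega M /\ M d] M by rewrite eM.
  have [_ /negP n1 MD] := idealM M OM.
  apply: n1; have := MD (- c) t (1 + t * c); rewrite !inE.
  by rewrite (_ : - c * t + _ = 1); [apply | ring].
(* If [s * f.[a]] were outside D, its denominator ideal would lie in some M. This M contains [d],
   hence occurs in [e]. It would contain the [u] of [sP] if it meets S, and otherwise a denominator
   of [f.[a]] taken from S. *)
exists s => // a; apply: contrapT => /coverM[M OM Mx].
have Md : M d.
  apply: Mx; rewrite mulrCA; apply: domM; first exact: dom_tofrac.
  exact: dom_horner.
have Me : M \in e.
  by have : [set M | Omega M /\ M d] M by []; rewrite eM.
have [tM|nM] := pselect (exists2 t, S t & M t).
  have [u nu uf] := sP M Me tM; apply: nu; apply: Mx.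
  rewrite mulrCA mulrA; exact: dom_horner.
have /(loc_domP multS)[t St tf] : loc_dom S f.[a%:K].
  apply: intf; exists a => //; exists 1; first exact: mult_subset1.
  by rewrite tofrac1 divr1.
apply: nM; exists t => //; apply: Mx; rewrite mulrCA.
by apply: domM => //; exact: dom_tofrac.
Qed.

(** * Zorn's lemma and unions of chains *)

Section Chains.
Variable T : Type.
Implicit Types (P F : set (set T)).

(** Zorn's lemma is applied to the sets X whose union with [I] satisfies [P]: this puts the maximal
    set above [I], and [P I] settles the empty chain. *)
Lemma Zorn_above P (I : set T) : P I ->
  (forall F, F `<=` P -> total_on F subset -> F !=set0 ->
    P (\bigcup_(X in F) X)) ->
  exists M, [/\ P M, I `<=` M & forall B, P B -> M `<=` B -> B = M].
Proof.
move=> PI Pchain.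
have [F FP Ftot|A [PA Amax]] := @Zorn_bigcup _ [set X | P (I `|` X)].
  (* Adjoining [set0] to [F] makes the family nonempty, as [Pchain] requires. *)
  have -> : [set X | P (I `|` X)] (\bigcup_(X in F) X) =
      P (\bigcup_(X in [set I `|` Y | Y in set0 |` F]) X).
    congr P; apply/seteqP; split=> x.
      case=> [Ix|[X FX Xx]].
        by exists (I `|` set0); [by exists set0; [left|]|left].
      by exists (I `|` X); [by exists X; [right|]|right].
    case=> _ [X [->|FX] <-] [Ix|Xx]; [by left | by case: Xx | by left |].
    by right; exists X.
  apply: Pchain.
  - by move=> _ [X [->|FX] <-]; [rewrite setU0 | exact: FP].
  - move=> _ _ [X FX <-] [Y FY <-].
    have [XY|YX] : X `<=` Y \/ Y `<=` X.
    + by case: FX FY => [->|FX] [->|FY]; [left | left | right | exact: Ftot].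
    + by left; exact: setUS.
    + by right; exact: setUS.
  - by exists (I `|` set0), set0; [left|].
exists (I `|` A); split; [exact: PA | exact: subsetUl |].
move=> B PB AB; apply/seteqP; split=> //.
have IB : I `|` B = B by apply/setUidPr => x Ix; apply: AB; left.
have BA : B `<=` A.
  apply: contrapT => nBA; apply: (Amax B); last by rewrite /= IB.
  by split=> // x Ax; apply: AB; right.
by move=> x /BA; right.
Qed.

End Chains.

(** Lets conditions on finitely many elements at a time, such as closure under [a * u + v], pass to
    unions of chains. *)
Lemma chain_sub_seq (T : choiceType) (F : set (set T)) (e : seq T) :
  total_on F subset -> F !=set0 -> [set` e] `<=` \bigcup_(X in F) X ->
  exists2 X, F X & [set` e] `<=` X.
Proof.
move=> Ftot [X0 FX0]; elim: e => [|x e IHe] eF; first by exists X0.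
have [Y FY eY] : exists2 Y, F Y & [set` e] `<=` Y.
  by apply: IHe => y /= ye; apply: eF; rewrite /= inE ye orbT.
have [X FX Xx] := eF x (mem_head _ _).
have [XY|YX] := Ftot X Y FX FY.
  by exists Y => // y /=; rewrite inE => /predU1P[->|/eY//]; exact: XY.
by exists X => // y /=; rewrite inE => /predU1P[->//|/eY/YX].
Qed.

(** * Maximal ideals and finite character *)

Lemma maximal_ideal_above (D : idomainType) (I : set D) :
  idealr_closed (mem I) -> exists2 M, maximal_ideal M & I `<=` M.
Proof.
move=> idI.
have [|M [idM IM maxM]] :=
  @Zorn_above D [set J : set D | idealr_closed (mem J)] I idI; last by exists M.
move=> F Fid Ftot [X0 FX0]; split.
- by rewrite inE; exists X0 => //; have [] := Fid _ FX0; rewrite inE.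
- apply/negP; rewrite inE => -[X FX X1]; have [_ /negP + _] := Fid X FX.
  by apply; rewrite inE.
- move=> a u v; rewrite !inE => Fu Fv.
  have [||X FX uvX] := @chain_sub_seq D F [:: u; v] Ftot.
  + by exists X0.
  + by move=> y /=; rewrite !inE => /orP[]/eqP ->; [exact: Fu | exact: Fv].
  exists X => //; have [_ _ /(_ a u v)] := Fid X FX; rewrite !inE; apply.
    by apply: uvX; rewrite /= inE eqxx.
  by apply: uvX; rewrite /= !inE eqxx orbT.
Qed.

Lemma poly_L_regular_finite_character (D : idomainType) :
  finite_character D -> poly_L_regular D.
Proof.
move=> finD; apply: (@poly_L_regular_finite_cover D (@maximal_ideal D)) => //.
  by move=> M [].
move=> x xD.
(* The denominator ideal of [x] misses 1 since [x] is not in D. *)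
have [|M maxM xM] := @maximal_ideal_above D [set y | dom D (y%:K * x)].
  split.
  - by rewrite inE /= tofrac0 mul0r; exact: dom0.
  - by apply/negP; rewrite inE /= tofrac1 mul1r.
  - move=> a u v; rewrite !inE /= tofracD tofracM mulrDl -mulrA => ux vx.
    by apply: domD => //; apply: domM => //; exact: dom_tofrac.
by exists M.
Qed.

(** * v-closures and t-closures *)

Section StarOperations.
Variable D : idomainType.
Implicit Types (x y z : {fraction D}) (I J W T M : set {fraction D})
  (e : seq {fraction D}).

Lemma inv_idealS W J : W `<=` J -> inv_ideal J `<=` inv_ideal W.
Proof. by move=> WJ x xJ y /WJ; exact: xJ. Qed.

Lemma sub_v_closure W : W `<=` v_closure W.
Proof. by move=> x Wx y; rewrite mulrC; exact. Qed.

Lemma v_closureS W J : W `<=` J -> v_closure W `<=` v_closure J.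
Proof. by move=> WJ; exact/inv_idealS/inv_idealS. Qed.

(** Taking inverses is an antitone Galois connection on subsets of K. *)
Lemma v_closure_inv W : v_closure (inv_ideal W) = inv_ideal W.
Proof.
by apply/seteqP; split; [exact/inv_idealS/sub_v_closure | exact: sub_v_closure].
Qed.

Lemma submodule_inv W : submodule (inv_ideal W).
Proof.
split=> [y _|a u v uW vW y Wy]; first by rewrite mul0r; exact: dom0.
rewrite mulrDl -mulrA; apply: domD; last exact: vW.
by apply: domM; [exact: dom_tofrac | exact: uW].
Qed.

Lemma submodule_sum I (J : finType) (c : J -> D) (F : J -> {fraction D}) :
  submodule I -> (forall j, I (F j)) -> I (\sum_j (c j)%:K * F j).
Proof.
move=> [I0 IM] IF; elim/big_ind : _ => // [x y Ix Iy|j _].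
  by have := IM 1 x y Ix Iy; rewrite tofrac1 mul1r.
by have := IM (c j) (F j) 0 (IF j) I0; rewrite addr0.
Qed.

(** Has the shape of the sets in [fin_gen], so that a list is directly a witness there. *)
Definition dspan e : set {fraction D} :=
  [set \sum_(i < size e) (c i)%:K * e`_i | c in [set: 'I_(size e) -> D]].

Lemma sub_dspan e : [set` e] `<=` dspan e.
Proof.
move=> x /= xe; have ie : (index x e < size e)%N by rewrite index_mem.
exists (fun i => (i == Ordinal ie)%:R) => //.
rewrite (bigD1 (Ordinal ie)) //= eqxx tofrac1 mul1r nth_index //.
by rewrite big1 ?addr0 // => i /negbTE ->; rewrite tofrac0 mul0r.
Qed.

Lemma dspan_sub e I : submodule I -> [set` e] `<=` I -> dspan e `<=` I.
Proof.
by move=> Imod eI _ [c _ <-]; apply: submodule_sum => // i; apply/eI/mem_nth.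
Qed.

Lemma submodule_dspan e : submodule (dspan e).
Proof.
split.
  by exists (fun=> 0) => //; rewrite big1 // => i _; rewrite tofrac0 mul0r.
move=> a _ _ [c _ <-] [c' _ <-]; exists (fun i => a * c i + c' i) => //.
rewrite mulr_sumr -big_split; apply: eq_bigr => i _ /=.
by rewrite tofracD tofracM mulrDl mulrA.
Qed.

(** A v-closure is an inverse, hence a submodule, hence contains the span. Bare lists can thus stand
    for finitely generated ideals. *)
Lemma v_closure_dspan e : v_closure (dspan e) = v_closure [set` e].
Proof.
apply/seteqP; split; last exact/v_closureS/sub_dspan.
rewrite -[X in _ `<=` X]v_closure_inv; apply: v_closureS.
by apply: dspan_sub; [exact: submodule_inv | exact: sub_v_closure].
Qed.

(** Reduces t-ideals to finite lists. A nonzero [z] of [T] is adjoined to the lists because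
    [t_closure] admits only nonzero ideals. *)
Lemma t_idealP T : nonzero_fractional_ideal T ->
  t_ideal T <-> forall e, [set` e] `<=` T -> v_closure [set` e] `<=` T.
Proof.
move=> fracT; have [[Tmod [d d0 dT]] [z Tz z0]] := fracT.
have span_fg e : z \in e -> [set` e] `<=` T ->
    [/\ nonzero_fractional_ideal (dspan e), fin_gen (dspan e) & dspan e `<=` T].
  move=> ze eT; have spT := dspan_sub Tmod eT; split=> //; last by exists e.
  split; last by exists z => //; exact: sub_dspan.
  by split; [exact: submodule_dspan | exists d => // x /spT; exact: dT].
have consT e : [set` e] `<=` T -> [set` z :: e] `<=` T.
  by move=> eT x /=; rewrite inE => /predU1P[->//|]; exact: eT.
split=> [[_ Tt] e eT x ex|tT].
  rewrite Tt; exists (dspan (z :: e)).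
    exact: span_fg (mem_head _ _) (consT _ eT).
  rewrite v_closure_dspan; apply: v_closureS ex => y /= ye.
  by rewrite inE ye orbT.
split=> //; apply/seteqP; split=> [x Tx|x [J [_ [e ->] JT]]].
  exists (dspan [:: z; x]).
    apply: span_fg; first exact: mem_head.
    by apply: consT => y /=; rewrite inE => /eqP ->.
  by apply/sub_v_closure/sub_dspan; rewrite /= !inE eqxx orbT.
by rewrite v_closure_dspan; apply: tT => y ye; apply/JT/sub_dspan.
Qed.

Lemma submodule_dom : submodule (dom D).
Proof.
split=> [|a u v uD vD]; first exact: dom0.
by apply: domD => //; apply: domM => //; exact: dom_tofrac.
Qed.

Lemma submodule_has1 I : submodule I -> I 1 -> dom D `<=` I.
Proof.
by move=> [I0 IM] I1 _ [a _ <-]; have := IM a 1 0 I1 I0; rewrite mulr1 addr0.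
Qed.

Lemma nonzero_ideal I : submodule I -> I `<=` dom D ->
  (exists2 x, I x & x != 0) -> nonzero_fractional_ideal I.
Proof.
move=> Imod ID Ix; split=> //; split=> //.
by exists 1; [exact: oner_neq0 | move=> x; rewrite tofrac1 mul1r; exact: ID].
Qed.

Lemma t_ideal_v I e : t_ideal I -> [set` e] `<=` I -> v_closure [set` e] `<=` I.
Proof. by move=> tI; have [/t_idealP[/(_ tI) + _] _] := tI; exact. Qed.

(** * Denominator ideals and t-maximal ideals *)

Definition colon x : set {fraction D} := [set y | dom D y /\ dom D (y * x)].

(** As an inverse, the denominator ideal is divisorial, which makes it a t-ideal. *)
Lemma colon_inv x : colon x = inv_ideal [set 1; x].
Proof.
apply/seteqP; split=> [y [y1 yx] _ [->|->] //|y yI]; first by rewrite mulr1.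
by split; [rewrite -[y]mulr1; apply: yI; left | apply: yI; right].
Qed.

Lemma t_ideal_colon x : t_ideal (colon x).
Proof.
apply/t_idealP; last first.
  move=> e; rewrite colon_inv -[X in _ -> _ `<=` X]v_closure_inv.
  exact: v_closureS.
apply: nonzero_ideal; first by rewrite colon_inv; exact: submodule_inv.
  by move=> y [].
have [d d0 dx] := dom_denominator x; exists d%:K; last by rewrite tofrac_eq0.
by split=> //; exact: dom_tofrac.
Qed.

Lemma colon_proper x : ~ dom D x -> colon x `<` dom D.
Proof.
move=> xD; split=> [y []//|/(_ 1)[]].
  by rewrite -tofrac1; exact: dom_tofrac.
by rewrite mul1r.
Qed.

(** By [t_idealP], the union of a nonempty chain of proper t-ideals of D is a t-ideal; it stays
    proper because each member misses 1. *)
Lemma t_maximal_above I : t_ideal I -> I `<` dom D ->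
  exists2 M, t_maximal M & I `<=` M.
Proof.
move=> tI properI.
have [|M [[tM properM] IM maxM]] := @Zorn_above {fraction D}
  [set J : set {fraction D} | t_ideal J /\ J `<` dom D] I (conj tI properI).
  move=> F Fid Ftot F0; have [X0 FX0] := F0; have [tX0 _] := Fid _ FX0.
  have Umod : submodule (\bigcup_(X in F) X).
    split; first by exists X0 => //; have [[[[]]]] := tX0.
    move=> a u v Fu Fv.
    have [|X FX uvX] := chain_sub_seq (e := [:: u; v]) Ftot F0.
      by move=> y /=; rewrite !inE => /orP[]/eqP ->; [exact: Fu | exact: Fv].
    exists X => //; have [[[[[_ XM] _] _] _] _] := Fid X FX; apply: XM.
      by apply: uvX; rewrite /= inE eqxx.
    by apply: uvX; rewrite /= !inE eqxx orbT.
  have UD : \bigcup_(X in F) X `<=` dom D.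
    by move=> x [X FX Xx]; have [_ [XD _]] := Fid X FX; exact: XD.
  split.
    apply/t_idealP.
      apply: nonzero_ideal => //; have [[_ [x Xx x0]] _] := tX0.
      by exists x => //; exists X0.
    move=> e /(chain_sub_seq Ftot F0)[X FX eX] x xe; exists X => //.
    by have [tX _] := Fid X FX; exact: (t_ideal_v tX eX).
  split=> // /(_ 1)[|X FX X1]; first by rewrite -tofrac1; exact: dom_tofrac.
  have [tX [_ nX]] := Fid X FX; apply: nX.
  by apply: submodule_has1 => //; have [[[]]] := tX.
by exists M => //; split=> // J tJ properJ; exact: maxM.
Qed.

Lemma t_maximal_has1 M : t_maximal M -> ~ M 1.
Proof.
move=> [[[[Mmod _] _] _] [_ nM] _] M1; apply: nM; exact: submodule_has1.
Qed.

(** The traces on D of the t-maximal ideals form the cover: for [x] outside D, [colon x] is a proper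
    t-ideal. *)
Lemma poly_L_regular_finite_t_character :
  finite_t_character D -> poly_L_regular D.
Proof.
move=> finD.
apply: (@poly_L_regular_finite_cover D
  [set (@FracField.tofrac D) @^-1` M | M in @t_maximal D]).
- move=> _ [M maxM <-]; have [[[[[M0 MM] _] _] _] _ _] := maxM; split.
  + by rewrite inE /= tofrac0.
  + by apply/negP; rewrite inE /= tofrac1; exact: t_maximal_has1.
  + by move=> a u v; rewrite !inE /= tofracD tofracM; exact: MM.
- move=> d /finD/(finite_image (fun M => (@FracField.tofrac D) @^-1` M)).
  apply: sub_finite_set => _ [[M maxM <-] Md]; exists M => //.
- move=> x xD.
  have [M maxM xM] := t_maximal_above (t_ideal_colon x) (colon_proper xD).
  exists ((@FracField.tofrac D) @^-1` M); first by exists M.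
  by move=> y yx; apply: xM; split=> //; exact: dom_tofrac.
Qed.

(** * Divisorial t-maximal ideals and TV domains *)

Lemma t_maximal_colon M x : t_maximal M -> ~ dom D x -> M `<=` colon x ->
  M = colon x.
Proof.
move=> [_ _ maxM] xD Mx; apply/esym/maxM => //; first exact: t_ideal_colon.
exact: colon_proper.
Qed.

(** If M^-1 were inside D, then 1 would lie in M_v = M. An x in M^-1 outside D puts M inside
    [colon x], and maximality gives equality. *)
Lemma divisorial_t_maximal_colon M : t_maximal M -> v_ideal M ->
  exists2 x, ~ dom D x & M = colon x.
Proof.
move=> maxM [_ Mv].
suff [x xM xD] : exists2 x, inv_ideal M x & ~ dom D x.
  exists x => //; apply: t_maximal_colon => // m Mm; split.
    by have [_ [+ _] _] := maxM; exact.
  by rewrite mulrC; exact: xM.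
apply: contrapT => nx; apply: (t_maximal_has1 maxM); rewrite Mv => x xM.
by rewrite mul1r; apply: contrapT => xD; apply: nx; exists x.
Qed.

(** For [y] outside [colon x], [colon (y * x)] is a proper t-ideal above [colon x], hence equal to
    it, and it contains [z]. *)
Lemma colon_prime x y z : t_maximal (colon x) -> dom D y -> dom D z ->
  colon x (y * z) -> ~ colon x y -> colon x z.
Proof.
move=> maxx yD zD [_ yzx] ny.
rewrite (@t_maximal_colon _ (y * x) maxx).
- by split; rewrite // mulrCA mulrA.
- by move=> yx; apply: ny.
- by move=> m [mD mx]; split=> //; rewrite mulrCA; exact: domM.
Qed.

(** Each member of [F] has an element outside [colon x]; by primality the product of these stays
    outside. *)
Lemma t_maximal_colon_avoids_meet x (F : seq (set {fraction D})) :
  t_maximal (colon x) ->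
  (forall M, M \in F -> [/\ submodule M, M `<=` dom D & ~ M `<=` colon x]) ->
  exists y, [/\ dom D y, ~ colon x y & forall M, M \in F -> M y].
Proof.
move=> maxx; elim: F => [|M F IHF] hF.
  exists 1; split=> //; last exact: t_maximal_has1.
  by rewrite -tofrac1; exact: dom_tofrac.
have [|y [yD ny yF]] := IHF.
  by move=> N NF; apply: hF; rewrite inE NF orbT.
have [Mmod MD Mx] := hF M (mem_head _ _).
have [z Mz nz] : exists2 z, M z & ~ colon x z.
  apply: contrapT => nz; apply: Mx => z Mz; apply: contrapT => xz.
  by apply: nz; exists z.
have idealM N w t : submodule N -> dom D w -> N t -> N (w * t).
  by move=> [N0 NM] [a _ <-] Nt; have := NM a t 0 Nt N0; rewrite addr0.
exists (y * z); split; first by apply: domM => //; exact: MD.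
  by move=> yz; apply: nz; apply: colon_prime yz ny => //; exact: MD.
move=> N; rewrite inE => /predU1P[->|NF]; first exact: idealM.
have [Nmod ND _] : [/\ submodule N, N `<=` dom D & ~ N `<=` colon x].
  by apply: hF; rewrite inE NF orbT.
by rewrite mulrC; apply: idealM; [| exact: MD | exact: yF].
Qed.

(* Houston and Zafrullah's argument.  Each t-maximal M containing d has the form
   (D : gen M).  If there are infinitely many, the y that multiply almost all
   [gen M] into D form a proper t-ideal I, contained in some t-maximal A.  The
   directed union T of the inverses of the finite intersections of the M <> A
   is a t-ideal, hence a v-ideal; as T^-1 is contained in I, [gen A] lies in T,
   so A contains a finite intersection of other t-maximal ideals, although A is
   prime. *)
Lemma TV_finite_t_character : TV_domain D -> finite_t_character D.
Proof.
move=> TV d d0; apply: contrapT; set L := [set M | _] => infL.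
have /choice[gen genP] : forall M, exists x,
    t_maximal M -> ~ dom D x /\ M = colon x.
  move=> M.
  have [maxM|] := pselect (t_maximal M); last by exists 0.
  have [tM _ _] := maxM.
  by have [x xD Mx] := divisorial_t_maximal_colon maxM (TV _ tM); exists x.
have dgen M : L M -> dom D (d%:K * gen M).
  by move=> [/genP[_ Mx]]; rewrite {1}Mx => -[].
have dK0 : d%:K != 0 by rewrite tofrac_eq0.
(* For [y] in D these are the M in [L] that miss [y], since M is [colon (gen M)]. So [I] collects
   the elements of D lying in almost all members of [L]. *)
pose bad y := [set M | L M /\ ~ dom D (y * gen M)].
pose I := [set y | dom D y /\ finite_set (bad y)].
have bad0 y : (forall M, L M -> dom D (y * gen M)) -> finite_set (bad y).
  by move=> yM; rewrite (_ : bad y = set0) // -subset0 => M [/yM].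
have tI : t_ideal I.
  apply/t_idealP.
    apply: nonzero_ideal; last 2 first.
    - by move=> y [].
    - by exists d%:K => //; split; [exact: dom_tofrac | exact: bad0].
    split.
      by split; [exact: dom0 | apply: bad0 => M _; rewrite mul0r; exact: dom0].
    move=> a u v [uD ubad] [vD vbad]; split.
      by have [_] := submodule_dom; apply.
    apply: (@sub_finite_set _ _ (bad u `|` bad v)); last by rewrite finite_setU.
    move=> M [LM nM]; have [uM|] := pselect (dom D (u * gen M)); last by left.
    right; split=> // vM; apply: nM; rewrite mulrDl -mulrA.
    by have [_] := submodule_dom; apply.
  (* Outside the finite set [E], all of [e] multiplies [gen M] into D. Thus [e] lies in the
     divisorial ideal [inv_ideal W], whose elements are bad only inside [E]. *)
  move=> e eI; pose E := \bigcup_(y in [set` e]) bad y.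
  have finE : finite_set E.
    by apply: bigcup_finite => [|y /eI[]//]; exact: finite_seq.
  pose W := [set x | x = 1 \/ exists M, [/\ L M, ~ E M & x = gen M]].
  have eW : [set` e] `<=` inv_ideal W.
    move=> y ye _ [->|[M [LM nE ->]]].
      by rewrite mulr1; have [] := eI y ye.
    by apply: contrapT => nM; apply: nE; exists y.
  move=> y /(v_closureS eW); rewrite v_closure_inv => yW; split.
    by rewrite -[y]mulr1; apply: yW; left.
  apply: sub_finite_set finE => M [LM nM]; apply: contrapT => nE.
  by apply: nM; apply: yW; right; exists M.
have [|A maxA IA] := t_maximal_above tI.
  split=> [y []//|/(_ 1)[]]; first by rewrite -tofrac1; exact: dom_tofrac.
  (* No [gen M] with M in [L] lies in D, so 1 is bad for the whole infinite set [L]. *)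
  move=> _; rewrite (_ : bad 1 = L) //; apply/seteqP; split=> M; first by case.
  by move=> LM; split=> //; rewrite mul1r; have [] := genP M LM.1.
have [genAD AE] := genP A maxA.
pose allowed (F : seq (set {fraction D})) := forall M, M \in F -> L M /\ M <> A.
pose meet (F : seq (set {fraction D})) :=
  [set y | dom D y /\ forall M, M \in F -> M y].
pose T := [set z | exists2 F, allowed F & inv_ideal (meet F) z].
have allowed_cat F G : allowed F -> allowed G -> allowed (F ++ G).
  by move=> aF aG M; rewrite mem_cat => /orP[/aF|/aG].
have meet_catl F G : meet (F ++ G) `<=` meet F.
  by move=> y [yD yFG]; split=> // M MF; apply: yFG; rewrite mem_cat MF.
have meet_catr F G : meet (F ++ G) `<=` meet G.
  by move=> y [yD yFG]; split=> // M MG; apply: yFG; rewrite mem_cat MG orbT.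
have T1 : T 1 by exists [::] => // y [yD _]; rewrite mul1r.
have Tdirected e : [set` e] `<=` T ->
    exists2 F, allowed F & [set` e] `<=` inv_ideal (meet F).
  elim: e => [|z e IHe] eT; first by exists [::].
  have [|F aF eF] := IHe.
    by move=> y /= ye; apply: eT; rewrite /= inE ye orbT.
  have [G aG zG] := eT z (mem_head _ _).
  exists (G ++ F); first exact: allowed_cat.
  move=> y /=; rewrite inE => /predU1P[->|/eF]; last exact/inv_idealS/meet_catr.
  exact: (inv_idealS (meet_catl G F)).
have tT : t_ideal T.
  apply/t_idealP.
    split; last by exists 1 => //; exact: oner_neq0.
    split.
      split; first by exists [::] => // y _; rewrite mul0r; exact: dom0.
      move=> a u v Tu Tv; have [|F aF uvF] := Tdirected [:: u; v].
        by move=> y /=; rewrite !inE => /orP[]/eqP ->.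
      exists F => //; have [_] := submodule_inv (meet F); apply; apply: uvF.
        by rewrite /= inE eqxx.
      by rewrite /= !inE eqxx orbT.
    (* Every allowed meet contains [d], which is therefore a common denominator for [T]. *)
    exists d => // x [F aF]; rewrite mulrC; apply; split.
      exact: dom_tofrac.
    by move=> M /aF[[]].
  move=> e /Tdirected[F aF eF] x /(v_closureS eF).
  by rewrite v_closure_inv; exists F.
have TgenA : T (gen A).
  have [_ ->] := TV _ tT => y yT.
  (* For M in [L] other than [A], [gen M] lies in the inverse of [meet [:: M]], hence in [T]. So
     [bad y] contains at most [A]. *)
  have yI : I y.
    split; first by rewrite -[y]mulr1; exact: yT.
    apply: sub_finite_set (finite_set1 A) => M [LM nM].
    apply: contrapT => /= MA; apply/nM/yT; exists [:: M].
      by move=> N; rewrite inE => /eqP ->.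
    move=> z [zD /(_ M (mem_head _ _))]; rewrite {1}(genP M LM.1).2 => -[_].
    by rewrite mulrC.
  by have := IA y yI; rewrite {1}AE mulrC => -[].
have [F aF AF] := TgenA.
(* By [AF], [meet F] lies inside [A]; this contradicts primality, as no member of [F] lies inside
   [A] by maximality. *)
have [||y [yD ny yF]] := @t_maximal_colon_avoids_meet (gen A) F.
- by rewrite -AE.
- move=> M /aF[[maxM _] MA]; have [[[[Mmod _] _] _] [MD MnD] maximM] := maxM.
  split=> //; rewrite -AE => MleA; apply: MA; apply/esym.
  by have [tA properA _] := maxA; exact: maximM.
by apply: ny; split=> //; rewrite mulrC; apply: AF.
Qed.

End StarOperations.

Theorem proposition2p4 (D : idomainType) :
  [/\ finite_t_character D -> poly_L_regular D,
      TV_domain D -> poly_L_regular D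
    & finite_character D -> poly_L_regular D].
Proof.
split; first exact: poly_L_regular_finite_t_character.
  by move=> /TV_finite_t_character; exact: poly_L_regular_finite_t_character.
exact: poly_L_regular_finite_character.
Qed.
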